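(* Let $F,B,X,\sigma,\rho,x_0$ be as in the context. Suppose that $\operatorname{Sol}(F,B)\neq\emptyset$ and that at every iteration $k\ge 1$ of the MAEG method there exists a stepsize $\lambda_k>0$ satisfying $\lambda_k\|F(x_k)-F(y_k)\|\le\sigma\|x_k-y_k\|$. Let $\{x_k\},\{y_k\},\{u_k\}$ be generated by the MAEG method with stepsizes satisfying $\lambda_k\in(\underline{\lambda},M\lambda_1)$ for some $\underline{\lambda}>0$ and $M>1$. Then: (i) If $\rho=0$, the sequence $\{y_k\}$ converges to $\Pi_{\operatorname{Sol}(F,B)}(x_0)$. (ii) If $0<\rho<\frac12$, both sequences $\{y_k\}$ and $\{u_k\}$ converge to the same point in $\operatorname{Sol}(F,B)$.
   Context: Problem: $F:\operatorname{dom}F\subseteq\mathbb{R}^n\to\mathbb{R}^n$ is a monotone, continuous (single-valued) operator and $B:\mathbb{R}^n\rightrightarrows\mathbb{R}^n$ is a set-valued maximal monotone operator with $\operatorname{cl}(\operatorname{dom}B)\subseteq\operatorname{dom}F$. $\operatorname{Sol}(F,B)=\{x: 0\in F(x)+B(x)\}$ (a closed convex set). $\Pi_C$ is the Euclidean projection onto a nonempty closed convex set $C$, and $J_{T}=(\operatorname{Id}+T)^{-1}$ is the resolvent. MAEG method. Input: $x_0\in\operatorname{cl}(\operatorname{dom}B)$, $\sigma\in(0,1)$, $\rho\in[0,\frac12)$, and a nonempty closed convex set $X$ with $\operatorname{cl}(\operatorname{dom}B)\subseteq X\subseteq\operatorname{dom}F$. Initialize $u_0=y_0=x_0$, $d_0=0$,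 $\Lambda_0=0$. For $k=1,2,\dots$: $$x_k=\Pi_X\bigl(\tau_ku_{k-1}+(1-\tau_k)(y_{k-1}-\lambda_kd_{k-1})\bigr),\qquad y_k=J_{\lambda_kB}\bigl(\tau_ku_{k-1}+(1-\tau_k)y_{k-1}-\lambda_kF(x_k)\bigr),$$ where $\tau_k=\frac{\lambda_k}{(1-2\rho)\Lambda_{k-1}+\lambda_k}$, $\Lambda_k=\sum_{i=1}^k\lambda_i$, and $\lambda_k>0$ is chosen so that $\lambda_k\|F(x_k)-F(y_k)\|\le\sigma\|x_k-y_k\|$; then $$d_k=\tfrac1{\lambda_k}\bigl(\tau_ku_{k-1}+(1-\tau_k)y_{k-1}-y_k\bigr)-F(x_k)+F(y_k),\qquad u_k=u_{k-1}-\rho\lambda_kd_k .$$ *)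

(* Defs.v *)
From HB Require Import structures.
From mathcomp Require Import all_boot all_order all_algebra.
From mathcomp Require Import all_classical all_reals all_analysis.
Set Implicit Arguments.
Unset Strict Implicit.
Unset Printing Implicit Defensive.
Import Order.TTheory GRing.Theory Num.Theory.
Import numFieldNormedType.Exports.
Local Open Scope classical_set_scope.
Local Open Scope ring_scope.

Section Euclidean.
Variables (R : realType) (n : nat).
Implicit Types (x y z : 'rV[R]_n) (C : set 'rV[R]_n).

Definition dotv x y : R := \sum_(i < n) x ord0 i * y ord0 i.

(* The norm that 'rV[R]_n carries in the library is the sup norm. It induces
   the topology used for closures, continuity and limits, but the projection
   and the stepsize test below need the Euclidean norm. *)
Definition enorm x : R := Num.sqrt (dotv x x).

Definition nearest C z : set 'rV[R]_n :=
  [set p | C p /\ forall q, C q -> enorm (z - p) <= enorm (z - q)].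

(* The default value 0 is only reached when C has no point nearest to z, which
   does not happen when C is nonempty, closed and convex. *)
Definition eproj C z : 'rV[R]_n := xget 0 (nearest C z).

End Euclidean.

Section Operators.
Variables (R : realType) (n : nat).
Local Notation V := ('rV[R]_n).
Local Notation oper := (V -> set V).
Implicit Types (A B T : oper) (D : set V) (F : V -> V).

Definition odom A : set V := [set x | A x !=set0].

Definition monotone_op A : Prop :=
  forall x y u v, A x u -> A y v -> 0 <= dotv (x - y) (u - v).

Definition maximal_monotone A : Prop :=
  monotone_op A /\
  forall A', monotone_op A' -> (forall x, A x `<=` A' x) ->
    forall x, A' x `<=` A x.

(* The operator with domain D that is single-valued with value F x at x \in D;
   values of F outside D are irrelevant. *)
Definition single D F : oper := fun x => [set u | D x /\ u = F x].

Definition oadd A B : oper := fun x => [set u + v | u in A x & v in B x].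

Definition oscale (a : R) A : oper := fun x => [set a *: v | v in A x].

(* J_T = (Id + T)^-1, as a set-valued map: p \in J_T z iff z \in p + T p. *)
Definition resolvent T : oper :=
  fun z => [set p | oadd (single setT id) T p z].

Definition Sol D F B : set V := [set x | oadd (single D F) B x 0].

End Operators.

Section MAEG.
Variables (R : realType) (n : nat).
Local Notation V := ('rV[R]_n).
Variables (F : V -> V) (B : V -> set V) (X : set V) (sigma rho : R).

Definition Lambda (lam : nat -> R) (k : nat) : R := \sum_(1 <= i < k.+1) lam i.

Definition tau (L l : R) : R := l / ((1 - 2 * rho) * L + l).

(* The stepsize l, tried from the state (L, u, y, d) of the previous iteration,
   yields the points x' and y' and is accepted. *)
Definition accepted (L : R) (u y d : V) (l : R) (x' y' : V) : Prop :=
  let t := tau L l in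
  [/\ 0 < l,
      x' = eproj X (t *: u + (1 - t) *: (y - l *: d)),
      resolvent (oscale l B) (t *: u + (1 - t) *: y - l *: F x') y' &
      l * enorm (F x' - F y') <= sigma * enorm (x' - y')].

(* lam 0 is unused; x 0 is constrained only so as to be the given input. *)
Definition maeg (x0 : V) (lam : nat -> R) (x y u d : nat -> V) : Prop :=
  [/\ [/\ x 0%N = x0, u 0%N = x0, y 0%N = x0 & d 0%N = 0] &
      forall k,
        let l := lam k.+1 in
        let t := tau (Lambda lam k) l in
        [/\ accepted (Lambda lam k) (u k) (y k) (d k) l (x k.+1) (y k.+1),
            d k.+1 = l^-1 *: (t *: u k + (1 - t) *: y k - y k.+1)
                     - F (x k.+1) + F (y k.+1) &
            u k.+1 = u k - (rho * l) *: d k.+1]].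

End MAEG.

(* Main.v *)
Require Import Defs.
From HB Require Import structures.
From mathcomp Require Import all_boot all_order all_algebra.
From mathcomp Require Import all_classical all_reals all_analysis.
From mathcomp Require Import ring lra.
Set Implicit Arguments.
Unset Strict Implicit.
Unset Printing Implicit Defensive.
Import Order.TTheory GRing.Theory Num.Theory.
Import numFieldNormedType.Exports.
Local Open Scope classical_set_scope.
Local Open Scope ring_scope.

(** Write A_k = (1 - 2 rho) Lambda_k, l = lambda_k, t = l / (A_(k-1) + l), and let
    T = F + B, a monotone operator with d_k in T y_k for k >= 1. Every z with
    <v, a - z> >= 0 for all v in T a, in particular every solution, makes

      Phi_k = A_k <d_k, y_k - u_k> + A_k^2 |d_k|^2 / 2 + |u_k - z|^2

    nonincreasing ([energy_decay]). The drop at each step is at least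

      rho l A_k |d_k|^2 + (1 - sigma^2) / 2 * ((A_(k-1) + l) / l)^2 |y_k - x_k|^2,

    and Phi_k bounds both A_k^2 |d_k|^2 / 4 and |u_k - z|^2 / 2 from above
    ([energy_lower]). As the stepsizes stay above a positive constant, A_k tends
    to infinity. So d_k tends to 0, and, the graph of T being closed
    ([approx_zeros_Sol]), every cluster point of y is a solution.

    If rho > 0, the drop dominates the perturbation in the recursion satisfied by
    |y_k - u_k|^2 ([gap_step]), which forces y_k - u_k to 0. The cluster points
    of u are then solutions. The first two terms of Phi_k do not depend on z, so
    for two such points p and q the difference |u_k - p|^2 - |u_k - q|^2 is a
    difference of two nonincreasing sequences and converges, which is only
    possible if p = q ([opial]).

    If rho = 0, then u_k = x0, and A_k |y_k - z|^2 grows by at most l times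
    2 <x0 - z, y_k - z> plus a term that tends to 0 ([anchored_step]). Take for z
    the projection of x0 onto the closed convex set [minty] of all the points z
    above. It contains the solutions, hence the cluster points of y, so
    <x0 - z, y_k - z> has a nonpositive upper limit and y tends to z. Then z is
    itself a solution, and the obtuse angle condition on the larger set [minty]
    makes it the projection of x0 onto the set of solutions. The reason for
    projecting onto [minty] is that, as an intersection of closed half-spaces, it
    is visibly closed and convex.

    Both recursions have the form handled by [weighted_decay]. *)

(** * Euclidean geometry of row vectors *)

Section EuclideanSpace.
Context {R : realType} {n : nat}.
Implicit Types (u v w x y z p q r : 'rV[R]_n) (a b : R) (C : set 'rV[R]_n).

Lemma dotvC x y : dotv x y = dotv y x.
Proof. by apply: eq_bigr => i _; rewrite mulrC. Qed.

Lemma dotvDl x y z : dotv (x + y) z = dotv x z + dotv y z.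
Proof. by rewrite -big_split; apply: eq_bigr => i _; rewrite !mxE mulrDl. Qed.

Lemma dotvZl a x y : dotv (a *: x) y = a * dotv x y.
Proof. by rewrite mulr_sumr; apply: eq_bigr => i _; rewrite !mxE mulrA. Qed.

Lemma dotvNl x y : dotv (- x) y = - dotv x y.
Proof. by rewrite -scaleN1r dotvZl mulN1r. Qed.

Lemma dotvDr x y z : dotv z (x + y) = dotv z x + dotv z y.
Proof. by rewrite !(dotvC z) dotvDl. Qed.

Lemma dotvZr a x y : dotv y (a *: x) = a * dotv y x.
Proof. by rewrite !(dotvC y) dotvZl. Qed.

Lemma dotvNr x y : dotv y (- x) = - dotv y x.
Proof. by rewrite !(dotvC y) dotvNl. Qed.

Definition dotv_linear :=
  (dotvDl, dotvDr, dotvNl, dotvNr, dotvZl, dotvZr).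

Lemma dotv0l x : dotv 0 x = 0.
Proof. by rewrite -(scale0r 0) dotvZl mul0r. Qed.

Lemma dotv0r x : dotv x 0 = 0.
Proof. by rewrite dotvC dotv0l. Qed.

Lemma dotv_ge0 x : 0 <= dotv x x.
Proof. by apply: sumr_ge0 => i _; rewrite -expr2 sqr_ge0. Qed.

Lemma enorm_ge0 x : 0 <= enorm x.
Proof. exact: sqrtr_ge0. Qed.

Lemma sqr_enorm x : enorm x ^+ 2 = dotv x x.
Proof. by rewrite sqr_sqrtr// dotv_ge0. Qed.

Lemma enormN x : enorm (- x) = enorm x.
Proof. by rewrite /enorm dotvNl dotvNr opprK. Qed.

Lemma enormBC x y : enorm (x - y) = enorm (y - x).
Proof. by rewrite -enormN opprB. Qed.

Lemma coord_le_enorm x i : `|x ord0 i| <= enorm x.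
Proof.
rewrite -(@ler_pXn2r _ 2)// ?nnegrE ?enorm_ge0// sqr_enorm real_normK ?num_real//.
rewrite /dotv (bigD1 i)//= -expr2 lerDl.
by apply: sumr_ge0 => j _; rewrite -expr2 sqr_ge0.
Qed.

Lemma enorm_eq0 x : enorm x <= 0 -> x = 0.
Proof.
move=> x0; apply/rowP => i; rewrite mxE; apply/eqP.
by rewrite -normr_le0 (le_trans (coord_le_enorm x i)).
Qed.

Lemma enorm_lt_coord x e : 0 < e ->
  (forall i, `|x ord0 i| < e / n.+1%:R) -> enorm x < e.
Proof.
move=> e0 xe; rewrite -(@ltr_pXn2r _ 2)// ?nnegrE ?enorm_ge0 ?(ltW e0)// sqr_enorm.
have le_coord i : x ord0 i * x ord0 i <= e ^+ 2 / n.+1%:R ^+ 2.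
  rewrite -expr2 -real_normK ?num_real// -exprVn -exprMn.
  by rewrite ler_pXn2r ?nnegrE// ?ltW// divr_gt0.
apply: (@le_lt_trans _ _ (\sum_(i < n) e ^+ 2 / n.+1%:R ^+ 2)).
  exact: ler_sum.
rewrite sumr_const card_ord -mulrnAr -[_ *+ n]mulr_natr gtr_pMr ?exprn_gt0//.
rewrite mulrC ltr_pdivrMr ?exprn_gt0// mul1r -natrX ltr_nat.
by rewrite expnS expn1 (leq_trans (ltnSn n))// leq_pmulr.
Qed.

(** Cauchy-Schwarz, from expanding the square of |y| x - |x| y. *)
Lemma dotv_le_enorm x y : dotv x y <= enorm x * enorm y.
Proof.
have := enorm_ge0 x; have := enorm_ge0 y.
rewrite le_eqVlt => /predU1P[y0|y0].
  by rewrite -y0 mulr0 (@enorm_eq0 y) ?dotv0r// -y0.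
rewrite le_eqVlt => /predU1P[x0|x0].
  by rewrite -x0 mul0r (@enorm_eq0 x) ?dotv0l// -x0.
have := dotv_ge0 (enorm y *: x - enorm x *: y).
rewrite !dotv_linear (dotvC y x) -!sqr_enorm => sq.
rewrite -subr_ge0 -(pmulr_rge0 _ (mulr_gt0 x0 y0)); nra.
Qed.

Lemma dotv_ge_enorm x y : - (enorm x * enorm y) <= dotv x y.
Proof. by rewrite -(enormN x) lerNl -dotvNl dotv_le_enorm. Qed.

Lemma enormD x y : enorm (x + y) <= enorm x + enorm y.
Proof.
rewrite -(@ler_pXn2r _ 2) ?nnegrE ?addr_ge0 ?enorm_ge0// sqrrD !sqr_enorm.
by rewrite !dotv_linear (dotvC y x); have := dotv_le_enorm x y; lra.
Qed.

Lemma enormB_triangle x y z : enorm (x - z) <= enorm (x - y) + enorm (y - z).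
Proof. by rewrite (le_trans _ (enormD _ _))// subrKA. Qed.

Lemma enormZ a x : enorm (a *: x) = `|a| * enorm x.
Proof.
by rewrite /enorm dotvZl dotvZr mulrA -expr2 sqrtrM ?sqr_ge0// sqrtr_sqr.
Qed.

Lemma enorm_le a x : 0 <= a -> dotv x x <= a ^+ 2 -> enorm x <= a.
Proof. by move=> a0; rewrite -sqr_enorm ler_pXn2r ?nnegrE ?enorm_ge0. Qed.

Lemma enorm_lt a x : 0 <= a -> dotv x x < a ^+ 2 -> enorm x < a.
Proof. by move=> a0; rewrite -sqr_enorm ltr_pXn2r ?nnegrE ?enorm_ge0. Qed.

(** The library topology of row vectors comes from the sup norm; Euclidean
    balls form another base of it. *)
Lemma nbhs_enormP x (A : set 'rV[R]_n) :
  nbhs x A <-> exists2 e, 0 < e & forall y, enorm (y - x) < e -> A y.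
Proof.
split=> [/nbhs_ballP[e /= e0 eA]|[e e0 eA]].
  exists e => // y yx; apply: eA; split=> // i j; rewrite ord1 /ball/=.
  rewrite distrC (le_lt_trans _ yx)// (le_trans _ (coord_le_enorm _ j))//.
  by rewrite !mxE.
apply/nbhs_ballP; exists (e / n.+1%:R) => /=; first by rewrite divr_gt0.
move=> y [_ xy]; apply: eA; apply: enorm_lt_coord => // i.
by have := xy ord0 i; rewrite /ball/= distrC !mxE.
Qed.

Lemma closure_enormP C x : closure C x <->
  forall e, 0 < e -> exists2 y, C y & enorm (y - x) < e.
Proof.
split=> [Cx e e0|Cx A /nbhs_enormP[e e0 eA]].
  have /Cx[y [Cy yx]] : nbhs x [set y | enorm (y - x) < e].
    by apply/nbhs_enormP; exists e.
  by exists y.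
by have [y Cy yx] := Cx e e0; exists y; split=> //; exact: eA.
Qed.

(** Bolzano-Weierstrass along the indices at which P holds, stated without
    extracting a subsequence. *)
Lemma frequently_cluster (s : nat -> 'rV[R]_n) (P : nat -> Prop) (M : R) :
  (forall k, enorm (s k) <= M) ->
  (forall N, exists2 k, (N <= k)%N & P k) ->
  exists p, forall e N, 0 < e ->
    exists k, [/\ (N <= k)%N, P k & enorm (s k - p) < e].
Proof.
move=> sM Pinf.
pose G : set (set 'rV[R]_n) :=
  [set A | exists N, forall k, (N <= k)%N -> P k -> A (s k)].
have GP : ProperFilter G.
  apply: Build_ProperFilter_ex => [A [N NA]|].
    by have [k Nk Pk] := Pinf N; exists (s k); exact: NA.
  split.
  - by exists 0%N.
  - move=> A B [N NA] [N' NB]; exists (maxn N N') => k; rewrite geq_max.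
    by move=> /andP[Nk N'k] Pk; split; [exact: NA|exact: NB].
  - by move=> A B AB [N NA]; exists N => k Nk Pk; exact/AB/NA.
have := @rV_compact R n (fun=> `[- M, M]%classic) (fun=> @segment_compact R _ _).
move=> /(_ G GP)[|p [_ Gp]].
  exists 0%N => k _ _ i /=; rewrite in_itv/= -ler_norml.
  by rewrite (le_trans (coord_le_enorm _ _)).
exists p => e N e0.
have tail : G [set v | exists k, [/\ (N <= k)%N, P k & s k = v]].
  by exists N => k Nk Pk; exists k.
have near : nbhs p [set v | enorm (v - p) < e] by apply/nbhs_enormP; exists e.
by have [_ [[k [Nk Pk <-]] /= kp]] := Gp _ _ tail near; exists k.
Qed.

End EuclideanSpace.

(** * Projection onto a closed convex set *)

Section Projection.
Context {R : realType} {n : nat}.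
Implicit Types (x y z p q : 'rV[R]_n) (C : set 'rV[R]_n).

Lemma convex_setP C : convex_set C -> forall x y t, C x -> C y ->
  0 <= t <= 1 -> C (t *: x + (1 - t) *: y).
Proof.
move=> Cconv x y t Cx Cy /andP[t0 t1].
by have /set_mem := Cconv x y (Itv01 t0 t1) (mem_set Cx) (mem_set Cy).
Qed.

Lemma nearest_exists C z : C !=set0 -> closed C -> nearest C z !=set0.
Proof.
move=> [c Cc] Ccl.
pose E : set R := [set enorm (z - q) | q in C].
have Elb : lbound E 0 by move=> _ [q _ <-]; exact: enorm_ge0.
have Einf : has_inf E by split; [exists (enorm (z - c)), c|exists 0].
have /choice[s sP] k : exists q, C q /\ enorm (z - q) < inf E + k.+1%:R^-1.
  have k0 : 0 < k.+1%:R^-1 :> R by rewrite invr_gt0.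
  by have [_ [q Cq <-] qk] := inf_adherent k0 Einf; exists q.
have [||p sp] :=
    @frequently_cluster _ _ s (fun=> True) (inf E + 1 + enorm z).
- move=> k; have [_ sk] := sP k.
  have -> : s k = - (z - s k) + z by rewrite opprB subrK.
  rewrite (le_trans (enormD _ _))// enormN lerD2r (le_trans (ltW sk))// lerD2l.
  by rewrite invf_le1// ler1n.
- by move=> N; exists N.
have Cp : C p.
  rewrite (closure_id C).1//; apply/closure_enormP => e e0.
  by have [k [_ _ kp]] := sp e 0%N e0; exists (s k) => //; exact: (sP k).1.
exists p; split=> // q Cq; apply/ler_addgt0Pr => e e0.
have e20 : 0 < e / 2 by rewrite divr_gt0.
have [N Ne] : exists N, N.+1%:R^-1 < e / 2 :> R.
  exists (Num.truncn ((e / 2)^-1)); rewrite invf_plt ?posrE//.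
  exact: truncnS_gt.
have [k [Nk _ kp]] := sp (e / 2) N e20; have [_ sk] := sP k.
have kN : k.+1%:R^-1 <= N.+1%:R^-1 :> R by rewrite lef_pV2 ?posrE// ler_nat.
have infq : inf E <= enorm (z - q) by apply: ge_inf; [exists 0|exists q].
have := enormB_triangle z (s k) p.
move: kN Ne sk infq; move: k.+1%:R^-1 N.+1%:R^-1 (inf E) => a b c'; lra.
Qed.

(** If p beats every p + t (q - p) with 0 < t <= 1, then
    2 <z - p, q - p> <= t |q - p|^2; were a = <z - p, q - p> positive, the choice
    t = a / (a + |q - p|^2) would violate this. *)
Lemma nearest_obtuse C z p : convex_set C -> nearest C z p ->
  forall q, C q -> dotv (z - p) (q - p) <= 0.
Proof.
move=> Cconv [Cp pmin] q Cq; rewrite leNgt; apply/negP => pos.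
set a := dotv (z - p) (q - p) in pos; set b := dotv (q - p) (q - p).
have b0 : 0 <= b by exact: dotv_ge0.
pose t := a / (a + b).
have ab0 : 0 < a + b by rewrite ltr_wpDr.
have t0 : 0 < t by rewrite divr_gt0.
have t1 : t <= 1 by rewrite ler_pdivrMr// mul1r lerDl.
have tab : t * (a + b) = a by rewrite divfK// gt_eqF.
have := pmin _ (convex_setP Cconv Cq Cp (introT andP (conj (ltW t0) t1))).
rewrite -(@ler_pXn2r _ 2) ?nnegrE ?enorm_ge0// !sqr_enorm.
have -> : z - (t *: q + (1 - t) *: p) = (z - p) - t *: (q - p).
  by apply/rowP => i; rewrite !mxE; ring.
have expand v w : dotv (v - t *: w) (v - t *: w) =
    dotv v v - 2 * t * dotv v w + t ^+ 2 * dotv w w.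
  by rewrite !dotv_linear (dotvC w v); ring.
rewrite expand -/a -/b => le0.
have : t * (t * b - 2 * a) >= 0 by lra.
rewrite pmulr_rge0// => le1.
have ta : 0 < t * a by rewrite mulr_gt0.
lra.
Qed.

Lemma eprojP C z : C !=set0 -> closed C -> convex_set C ->
  C (eproj C z) /\ forall q, C q -> dotv (z - eproj C z) (q - eproj C z) <= 0.
Proof.
move=> C0 Ccl Cconv.
have near : nearest C z (eproj C z) by apply: xgetPex; exact: nearest_exists.
by split; [exact: near.1|exact: nearest_obtuse near].
Qed.

(** The obtuse angle condition makes p the only nearest point, since it gives
    |z - q|^2 >= |z - p|^2 + |p - q|^2. *)
Lemma eproj_obtuse C z p : C p ->
  (forall q, C q -> dotv (z - p) (q - p) <= 0) -> eproj C z = p.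
Proof.
move=> Cp obt.
have pyth q : C q -> dotv (z - p) (z - p) + dotv (q - p) (q - p) <=
    dotv (z - q) (z - q).
  move=> /obt; have -> : z - q = (z - p) - (q - p) by rewrite opprB addrA subrK.
  by move: (z - p) (q - p) => v w; rewrite !dotv_linear (dotvC w v); lra.
have near : nearest C z p.
  split=> // q /pyth; have := dotv_ge0 (q - p) => ? ?.
  by rewrite -(@ler_pXn2r _ 2) ?nnegrE ?enorm_ge0// !sqr_enorm; lra.
have [Ce /(_ _ Cp)] : nearest C z (eproj C z) by apply: xgetPex; exists p.
rewrite -(@ler_pXn2r _ 2) ?nnegrE ?enorm_ge0// !sqr_enorm => le_ep.
apply/eqP; rewrite -subr_eq0; apply/eqP/enorm_eq0/enorm_le => //.
by rewrite expr0n/=; have := pyth _ Ce; lra.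
Qed.

End Projection.

(** * The operator F + B *)

Section SumOperator.
Context {R : realType} {n : nat}.
Local Notation V := 'rV[R]_n.
Variables (D : set V) (F : V -> V) (B : V -> set V).
Local Notation T := (oadd (single D F) B).

Lemma oadd_singleP a v : T a v <-> D a /\ B a (v - F a).
Proof.
split=> [[_ [Da ->]] [b Bb <-]|[Da Bv]]; first by rewrite addrC addKr.
by exists (F a) => //; exists (v - F a) => //; rewrite addrC subrK.
Qed.

Lemma monotone_oadd : monotone_op (single D F) -> monotone_op B ->
  monotone_op T.
Proof.
move=> Fmono Bmono a b u v /oadd_singleP[Da Bu] /oadd_singleP[Db Bv].
have -> : u - v = (F a - F b) + ((u - F a) - (v - F b)).
  by apply/rowP => i; rewrite !mxE; ring.
by rewrite dotvDr addr_ge0//; [apply: Fmono; split|exact: Bmono].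
Qed.

(** Limits of almost-zeros of F + B are zeros: along such points F tends to F p,
    so -F p is monotonically related to the graph of B, and B has no room to
    be extended by it. The operator B' of the proof is that extension. *)
Lemma approx_zeros_Sol p : {within D, continuous F} -> maximal_monotone B ->
  closure (odom B) `<=` D ->
  (forall e, 0 < e -> exists a v, [/\ T a v, enorm (a - p) < e & enorm v < e]) ->
  Sol D F B p.
Proof.
move=> Fcont [Bmono Bmax] BD approx.
have Dp : D p.
  apply/BD/closure_enormP => e /approx[a [v [/oadd_singleP[_ Ba] ap _]]].
  by exists a => //; exists (v - F a).
have Fp e : 0 < e -> exists2 del, 0 < del &
    forall a, D a -> enorm (a - p) < del -> enorm (F a - F p) < e.
  move=> e0.
  have nearFp : nbhs (F p) [set w | enorm (w - F p) < e].
    by apply/nbhs_enormP; exists e.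
  have : within D (nbhs p) [set a | enorm (F a - F p) < e].
    by rewrite (nbhs_subspace_in Dp); exact: Fcont nearFp.
  move=> /nbhs_enormP[del del0 delF].
  by exists del => // a Da ap; exact: delF.
apply/oadd_singleP; split=> //; rewrite sub0r.
pose B' x : set V := [set w | B x w \/ x = p /\ w = - F p].
have rel a b : B a b -> 0 <= dotv (a - p) (b + F p).
  move=> Bab; apply/ler_addgt0Pr => e e0.
  pose K := 2 * (enorm (a - p) + 1) + enorm (b + F p) + 1.
  have K0 : 0 < K.
    by rewrite /K; have := enorm_ge0 (a - p); have := enorm_ge0 (b + F p); lra.
  have [eta [eta0 eta1 etaK]] : exists eta, [/\ 0 < eta, eta <= 1 & eta * K <= e].
    exists (Num.min 1 (e / K)); rewrite lt_min ltr01 divr_gt0//; split=> //.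
      by rewrite ge_min lexx.
    by rewrite -ler_pdivlMr// ge_min lexx orbT.
  have [del del0 Fdel] := Fp _ eta0.
  have [|a' [v' [/oadd_singleP[Da' Ba'] a'p v'p]]] := approx (Num.min eta del).
    by rewrite lt_min eta0.
  move: a'p v'p; rewrite !lt_min => /andP[a'eta a'del] /andP[v'eta _].
  have Feta := Fdel _ Da' a'del.
  have mono := Bmono _ _ _ _ Bab Ba'.
  have split_dot : dotv (a - p) (b + F p) =
      dotv (a - a') (b - (v' - F a')) + dotv (a - a') (v' - (F a' - F p))
      + dotv (a' - p) (b + F p).
    have -> : a' - p = (a - p) - (a - a').
      by apply/rowP => i; rewrite !mxE; ring.
    have -> : b + F p = (b - (v' - F a')) + (v' - (F a' - F p)).
      by apply/rowP => i; rewrite !mxE; ring.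
    by rewrite !(dotvDl, dotvNl, dotvDr (_ - _)); ring.
  rewrite split_dot.
  have := dotv_ge_enorm (a - a') (v' - (F a' - F p)).
  have := dotv_ge_enorm (a' - p) (b + F p).
  have := enormD v' (- (F a' - F p)); rewrite enormN => v'F.
  have := enormB_triangle a p a'; rewrite (enormBC p) => aa'.
  have : enorm (a - a') * enorm (v' - (F a' - F p)) <=
      (enorm (a - p) + 1) * (2 * eta).
    by apply: ler_pM; rewrite ?enorm_ge0//; lra.
  have : enorm (a' - p) * enorm (b + F p) <= eta * enorm (b + F p).
    by rewrite ler_wpM2r ?enorm_ge0// ltW.
  by move: etaK; rewrite /K; lra.
apply: (Bmax B') => [|x w Bw|]; [|by left|by right].
move=> a b u v [Bau|[-> ->]] [Bbv|[-> ->]].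
- exact: Bmono.
- by rewrite opprK rel.
- by rewrite -opprB dotvNl -[X in dotv _ X]opprB dotvNr !opprK rel.
- by rewrite !subrr dotv0l.
Qed.

(** The closed convex set that F + B cannot tell from its zeros: it is cut out
    by one half-space per point of the graph. When rho = 0, the projection of the
    starting point onto it turns out to be a zero. *)
Definition minty : set V := [set z | forall a v, T a v -> 0 <= dotv v (a - z)].

Lemma Sol_minty : monotone_op T -> Sol D F B `<=` minty.
Proof. by move=> Tmono z Tz a v Tv; rewrite dotvC -(subr0 v); exact: Tmono. Qed.

Lemma closed_minty : closed minty.
Proof.
move=> z zcl a v Tv; apply/ler_addgt0Pr => e e0.
have v1 : 0 < enorm v + 1 by rewrite ltr_wpDl ?enorm_ge0.
have /closure_enormP/(_ (e / (enorm v + 1)))[|s sS sz] := zcl.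
  by rewrite divr_gt0.
have -> : a - z = (a - s) + (s - z) by rewrite subrKA.
rewrite dotvDr; have := sS _ _ Tv; have := dotv_ge_enorm v (s - z).
have : enorm v * enorm (s - z) <= (enorm v + 1) * enorm (s - z).
  by rewrite ler_wpM2r ?enorm_ge0// lerDl.
by move: sz; rewrite ltr_pdivlMr// mulrC; lra.
Qed.

Lemma convex_minty : convex_set minty.
Proof.
move=> x y t /set_mem xS /set_mem yS; apply/mem_set => a v Tv.
have -> : a - (t%:num *: x + (1 - t%:num) *: y) =
    t%:num *: (a - x) + (1 - t%:num) *: (a - y).
  by apply/rowP => i; rewrite !mxE; ring.
rewrite dotvDr !dotvZr addr_ge0// mulr_ge0// ?subr_ge0//.
  exact: xS.
exact: yS.
Qed.

End SumOperator.

(** * Real sequences *)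

Section RealSequences.
Context {R : realType}.
Implicit Types (Phi A s b : nat -> R) (C : R).

Lemma nonincreasing_seqP Phi : (forall k, Phi k.+1 <= Phi k) ->
  forall N k, (N <= k)%N -> Phi k <= Phi N.
Proof.
move=> dec N k /subnK <-; elim: (k - N)%N => [|m IH]; first by rewrite add0n.
by rewrite addSn (le_trans _ IH).
Qed.

Lemma nonincreasing_cauchy Phi : (forall k, Phi k.+1 <= Phi k) ->
  (forall k, 0 <= Phi k) ->
  forall e, 0 < e -> exists N, forall k, (N <= k)%N -> Phi N - Phi k < e.
Proof.
move=> dec ge0 e e0.
have inf0 : has_inf (range Phi).
  by split; [exists (Phi 0%N), 0%N|exists 0 => _ [k _ <-]].
have [_ [N _ <-] PhiN] := inf_adherent e0 inf0.
exists N => k Nk; have : inf (range Phi) <= Phi k.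
  by apply: ge_inf; [exact: inf0.2|exists k].
lra.
Qed.

(** A discrete form of the rule that s tends to 0 when
    (A s)' <= A' b + C A |Phi'| with b eventually small and Phi of finite variation: dividing the summed
    inequality by A, the second term is a weighted mean of b and the third is at
    most a tail of the variation of Phi. It contains both the lemmas of Cesaro
    and of Kronecker in the form needed here. *)
Lemma weighted_decay A s b Phi C :
  0 <= C -> (forall k, 0 <= A k <= A k.+1) ->
  (forall m, exists N, forall k, (N <= k)%N -> m < A k) ->
  (forall k, Phi k.+1 <= Phi k) -> (forall k, 0 <= Phi k) ->
  (forall e, 0 < e -> exists N, forall k, (N <= k)%N -> b k <= e) ->
  (forall k, A k.+1 * s k.+1 <=
     A k * s k + (A k.+1 - A k) * b k + C * A k.+1 * (Phi k - Phi k.+1)) ->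
  forall e, 0 < e -> exists N, forall k, (N <= k)%N -> s k < e.
Proof.
move=> C0 Ainc Ainf Phidec Phi0 bsmall step e e0.
have e30 : 0 < e / 3 by rewrite divr_gt0.
have [N1 bN] := bsmall _ e30.
have C1 : 0 < C + 1 by rewrite ltr_wpDl.
have [N2 PhiN] := nonincreasing_cauchy Phidec Phi0 (divr_gt0 e30 C1).
pose N := maxn N1 N2.
have acc k : (N <= k)%N -> A k * s k <=
    A N * s N + (A k - A N) * (e / 3) + C * A k * (Phi N - Phi k).
  move=> /subnK <-; elim: (k - N)%N => [|m IH].
    by rewrite add0n !subrr mul0r mulr0 !addr0.
  rewrite addSn; set j := (m + N)%N in IH *.
  have Nj : (N <= j)%N by exact: leq_addl.
  have bj : b j <= e / 3 by apply: bN; rewrite (leq_trans _ Nj)// leq_maxl.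
  have /andP[Aj0 Ajj] := Ainc j.
  have PhiNj := nonincreasing_seqP Phidec Nj.
  have : (A j.+1 - A j) * b j <= (A j.+1 - A j) * (e / 3).
    by rewrite ler_wpM2l// subr_ge0.
  have : C * A j * (Phi N - Phi j) <= C * A j.+1 * (Phi N - Phi j).
    by rewrite ler_wpM2r ?subr_ge0// ler_wpM2l.
  by have := step j; lra.
have [N3 AN3] := Ainf (Num.max 0 (A N * s N / (e / 3))).
exists (maxn N N3) => k; rewrite geq_max => /andP[Nk N3k].
have := AN3 _ N3k; rewrite gt_max ltr_pdivrMr// => /andP[Ak0 ANk].
have Phik : (C + 1) * (Phi N - Phi k) <= e / 3.
  rewrite mulrC -ler_pdivlMr// ltW// (le_lt_trans _ (PhiN k _)) //.
    by rewrite lerD2r nonincreasing_seqP// leq_maxr.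
  by rewrite (leq_trans _ Nk)// leq_maxr.
have PhiNk := nonincreasing_seqP Phidec Nk.
have AkPhi : C * A k * (Phi N - Phi k) <= A k * (e / 3).
  rewrite mulrAC mulrC ler_wpM2l ?(ltW Ak0)// (le_trans _ Phik)//.
  by rewrite ler_wpM2r ?subr_ge0// lerDl.
have /andP[AN0 _] := Ainc N.
rewrite -(ltr_pM2l Ak0); have := acc _ Nk.
have : (A k - A N) * (e / 3) <= A k * (e / 3).
  by rewrite ler_wpM2r ?(ltW e30)// gerBl.
by lra.
Qed.

End RealSequences.

(** * One iteration *)

Section OneStep.
Context {R : realType} {n : nat}.
Implicit Types (u y d x e z r v : 'rV[R]_n) (A l rho sigma : R).

Definition energy A d y u z : R :=
  A * dotv d (y - u) + A ^+ 2 / 2 * dotv d d + dotv (u - z) (u - z).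

(** Replacing y by z in the first term completes two squares, with
    |A d - 2 (u - z)|^2 and |A d - (u - z)|^2 left over. *)
Lemma energy_lower A d y u z : 0 <= A * dotv d (y - z) ->
  A ^+ 2 * dotv d d <= 4 * energy A d y u z /\
  dotv (u - z) (u - z) <= 2 * energy A d y u z.
Proof.
rewrite /energy; have -> : y - u = (y - z) - (u - z).
  by apply/rowP => i; rewrite !mxE; ring.
move: (y - z) (u - z) => a v Ada.
have := dotv_ge0 (A *: d - v); have := dotv_ge0 (A *: d - 2 *: v).
rewrite !dotv_linear (dotvC v d); split; lra.
Qed.

(** v = (v + r) - r is the difference of two vectors at an obtuse angle, hence at
    least as long as either. *)
Lemma obtuse_le r v : dotv (v + r) r <= 0 -> dotv r r <= dotv v v.
Proof.
by have := dotv_ge0 (v + r); rewrite !dotv_linear (dotvC r v); lra.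
Qed.

(** In the lemmas below, primed letters belong to the new iterate,
    e = l (F y' - F x) is the error of the extragradient step, and A' is the new
    weight; y'E is the definition of d' solved for y'. *)
Section Step.
Context {A l rho sigma : R} {u y d x y' d' e : 'rV[R]_n}.
Let t := l / (A + l).
Hypotheses (A0 : 0 <= A) (l0 : 0 < l) (rho0 : 0 <= rho <= 1)
  (sigma1 : sigma ^+ 2 <= 1).
Hypothesis y'E : y' = t *: u + (1 - t) *: y - l *: d' + e.
Hypothesis e_small : dotv e e <= sigma ^+ 2 * dotv (y' - x) (y' - x).
Local Notation A' := (A + (1 - 2 * rho) * l).
Local Notation u' := (u - (rho * l) *: d').
Local Notation K := ((A + l) / l).

Let Al0 : 0 < A + l. Proof. exact: ltr_wpDl. Qed.
Let Al : A + l != 0. Proof. by rewrite gt_eqF. Qed.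
Let ln0 : l != 0. Proof. by rewrite gt_eqF. Qed.

(** With q = l d' - (1 - t) l d, the projection inequality reads
    |y' - x| <= |q - e|, and the difference of the two sides is the nonnegative
    combination
      K A <d' - d, y' - y> + 2 rho l <d', y' - z>
      + K^2 / 2 (|q - e|^2 - |y' - x|^2) + K^2 / 2 (sigma^2 |y' - x|^2 - |e|^2).
    The factor A is part of the monotonicity hypothesis because the initial d
    need not be a value of the operator; there A = 0. *)
Lemma energy_decay z :
  dotv (t *: u + (1 - t) *: (y - l *: d) - x) (y' - x) <= 0 ->
  0 <= A * dotv (d' - d) (y' - y) -> 0 <= dotv d' (y' - z) ->
  energy A' d' y' u' z + (rho * l * A' + (rho * l) ^+ 2) * dotv d' d'
    + (1 - sigma ^+ 2) / 2 * K ^+ 2 * dotv (y' - x) (y' - x)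
  <= energy A d y u z.
Proof.
move=> proj mono sol.
pose q := l *: d' - ((1 - t) * l) *: d - e.
have rq : dotv (y' - x) (y' - x) <= dotv q q.
  apply: obtuse_le; apply: le_trans proj; rewrite le_eqVlt; apply/orP; left.
  apply/eqP; congr dotv; apply/rowP => i; rewrite y'E /q !mxE; ring.
move: mono sol e_small rq; set r := dotv (y' - x) (y' - x).
have -> : y' - y = - (t *: (y - u)) - l *: d' + e.
  by apply/rowP => i; rewrite y'E !mxE; ring.
have -> : y' - z = (1 - t) *: (y - u) + (u - z) - l *: d' + e.
  by apply/rowP => i; rewrite y'E !mxE; ring.
rewrite /energy.
have -> : y' - u' = (1 - t) *: (y - u) - ((1 - rho) * l) *: d' + e.
  by apply/rowP => i; rewrite y'E !mxE; ring.
have -> : u' - z = (u - z) - (rho * l) *: d' by rewrite addrAC.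
rewrite /q; move: (y - u) (u - z) => a b.
rewrite !dotv_linear.
rewrite ?(dotvC e d') ?(dotvC e d) ?(dotvC d d') ?(dotvC a d') ?(dotvC b d').
rewrite ?(dotvC b a) ?(dotvC e a) ?(dotvC e b) ?(dotvC d a).
move=> mono sol er rq; rewrite -subr_ge0.
set mono' := (X in 0 <= X) in mono; set sol' := (X in 0 <= X) in sol.
set q' := (X in _ <= X) in rq.
set G := (X in 0 <= X).
have -> : G = K * mono' + 2 * rho * l * sol' + K ^+ 2 / 2 * (q' - r)
    + K ^+ 2 / 2 * (sigma ^+ 2 * r - dotv e e).
  rewrite /G /mono' /sol' /q' /t; field; exact/andP.
have K0 : 0 <= K by rewrite divr_ge0// ltW.
have K20 : 0 <= K ^+ 2 / 2 by rewrite divr_ge0// sqr_ge0.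
have [rho_ge0 _] := andP rho0.
by rewrite !addr_ge0// mulr_ge0// ?subr_ge0// !mulr_ge0// ltW.
Qed.

(** y' - u' is the average, with weights 1 - t and t, of y - u and of a vector h
    made of e and d'; apply the convexity of the squared norm. *)
Lemma gap_step :
  (A + l) * dotv (y' - u') (y' - u') <= A * dotv (y - u) (y - u)
    + l * (2 * (A + l) ^+ 2 * dotv d' d' + 2 * K ^+ 2 * dotv (y' - x) (y' - x)).
Proof.
move: e_small; set r := dotv (y' - x) (y' - x) => er.
have r0 : 0 <= r by exact: dotv_ge0.
have -> : y' - u' =
    (1 - t) *: (y - u) + t *: (K *: e - ((1 - rho) * (A + l)) *: d').
  apply/rowP => i; rewrite y'E !mxE /t; field; exact/andP.
pose h := K *: e - ((1 - rho) * (A + l)) *: d'; rewrite -/h.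
have hle : dotv h h <= 2 * (A + l) ^+ 2 * dotv d' d' + 2 * K ^+ 2 * r.
  have : dotv h h <= 2 * K ^+ 2 * dotv e e
      + 2 * ((1 - rho) * (A + l)) ^+ 2 * dotv d' d'.
    have := dotv_ge0 (K *: e + ((1 - rho) * (A + l)) *: d').
    by rewrite /h !dotv_linear (dotvC d' e); move: K => k; lra.
  have : 2 * K ^+ 2 * dotv e e <= 2 * K ^+ 2 * r.
    apply: ler_wpM2l; first by rewrite mulr_ge0 ?sqr_ge0.
    rewrite (le_trans er)//.
    by rewrite -[leRHS]mul1r ler_wpM2r.
  have : 2 * ((1 - rho) * (A + l)) ^+ 2 * dotv d' d'
      <= 2 * (A + l) ^+ 2 * dotv d' d'.
    rewrite ler_wpM2r ?dotv_ge0// ler_wpM2l// exprMn.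
    by have /andP[? ?] := rho0; rewrite -[leRHS]mul1r ler_wpM2r ?sqr_ge0//; nra.
  lra.
have lh := ler_wpM2l (ltW l0) hle.
apply: (le_trans _ (lerD (lexx _) lh)).
move: (y - u) h {hle lh} => a h.
have := dotv_ge0 (a - h).
rewrite !dotv_linear (dotvC h a) => ah.
rewrite -subr_ge0; set G := (X in 0 <= X).
have -> : G = A * t * (dotv a a - dotv a h - (dotv a h - dotv h h)).
  rewrite /G /t; field; exact: Al.
rewrite mulr_ge0//; last lra.
by rewrite mulr_ge0// divr_ge0// ltW.
Qed.

(** Solve y'E for (1 - t) (y - z), take squared norms, and drop the term in
    <d', y' - z>. *)
Lemma anchored_step z : 0 <= dotv d' (y' - z) ->
  (A + l) * dotv (y' - z) (y' - z) <= A * dotv (y - z) (y - z)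
    + l * (2 * dotv (u - z) (y' - z)
           + 2 * (K * enorm (y' - x)) * enorm (y' - z)).
Proof.
move=> sol.
have e_le : enorm e <= enorm (y' - x).
  rewrite enorm_le ?enorm_ge0// sqr_enorm (le_trans e_small)//.
  by rewrite -[leRHS]mul1r ler_wpM2r ?dotv_ge0.
have err : dotv e (y' - z) <= enorm (y' - x) * enorm (y' - z).
  by rewrite (le_trans (dotv_le_enorm _ _))// ler_wpM2r ?enorm_ge0.
have step : (1 - t) *: (y - z) = (y' - z) + (l *: d' - t *: (u - z) - e).
  by apply/rowP => i; rewrite y'E !mxE; ring.
have := congr1 (fun v => dotv v v) step.
rewrite /= dotvZl dotvZr.
move: (y' - z) (u - z) (dotv (y - z) (y - z)) (dotv_ge0 (y - z)) sol err.
move=> p v s s0 sol err; set g := l *: d' - t *: v - e => sE.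
have lin w : dotv p p + 2 * dotv p w <= dotv (p + w) (p + w).
  by have := dotv_ge0 w; rewrite !dotv_linear (dotvC w p); lra.
have := lin g; rewrite -sE [in X in X -> _]/g !dotv_linear.
rewrite !(dotvC p) => pp.
have := ler_wpM2l (ltW Al0) pp.
have Kerr : l * (K * dotv e p) <= l * (K * (enorm (y' - x) * enorm p)).
  by rewrite ler_wpM2l ?(ltW l0)// ler_wpM2l// divr_ge0// ltW.
have -> : (A + l) * ((1 - t) * ((1 - t) * s)) = A * s - A * t * s.
  by rewrite /t; field.
have Ats : 0 <= A * t * s by rewrite mulr_ge0// mulr_ge0// divr_ge0// ltW.
have -> : (A + l) * (dotv p p + 2 * (l * dotv d' p - t * dotv v p - dotv e p))
    = (A + l) * dotv p p + 2 * (A + l) * (l * dotv d' p) - 2 * (l * dotv v p)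
      - 2 * (l * (K * dotv e p)).
  by rewrite /t; field; exact/andP.
have : 0 <= 2 * (A + l) * (l * dotv d' p).
  by rewrite mulr_ge0 ?mulr_ge0// ?(ltW Al0)// ltW.
lra.
Qed.

End Step.

End OneStep.

(** * Cluster points *)

Section ClusterPoints.
Context {R : realType} {n : nat}.
Implicit Types (s : nat -> 'rV[R]_n) (p q : 'rV[R]_n).

Definition cluster_point s p :=
  forall (e : R) N, 0 < e -> exists2 k, (N <= k)%N & enorm (s k - p) < e.

Definition enorm_cvg s p :=
  forall e : R, 0 < e -> exists N, forall k, (N <= k)%N -> enorm (s k - p) < e.

Lemma cvgn_enorm s p : enorm_cvg s p -> s k @[k --> \oo] --> p.
Proof.
move=> sp A /nbhs_enormP[e e0 eA]; have [N sN] := sp e e0.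
by exists N => // k /= Nk; apply: eA; exact: sN.
Qed.

Lemma cluster_point_cvg s p : enorm_cvg s p -> cluster_point s p.
Proof.
move=> sp e N /sp[N' sN']; exists (maxn N N'); first exact: leq_maxl.
exact/sN'/leq_maxr.
Qed.

Lemma bounded_cluster_point s M : (forall k, enorm (s k) <= M) ->
  exists p, cluster_point s p.
Proof.
move=> sM; have [|p sp] := @frequently_cluster _ _ s (fun=> True) M sM.
  by move=> N; exists N.
by exists p => e N e0; have [k [Nk _ kp]] := sp e N e0; exists k.
Qed.

Lemma unique_cluster_point_cvg s p M : (forall k, enorm (s k) <= M) ->
  (forall q, cluster_point s q -> q = p) -> enorm_cvg s p.
Proof.
move=> sM uniq e e0; apply: contrapT => /forallNP far.
have [|q sq] := @frequently_cluster _ _ s (fun k => e <= enorm (s k - p)) M sM.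
  move=> N; have /existsNP[k /not_implyP[Nk /negP]] := far N.
  by rewrite -leNgt => ?; exists k.
have qp : q = p.
  by apply: uniq => e' N e'0; have [k [Nk _ kq]] := sq e' N e'0; exists k.
have [k [_ ek]] := sq e 0%N e0.
by rewrite qp ltNge ek.
Qed.

(** The argument of Opial: if |s - p|^2 - |s - q|^2 has a limit, then that limit
    is - |p - q|^2 near p and |p - q|^2 near q. *)
Lemma opial s p q (Phi Psi : nat -> R) :
  (forall k, Phi k.+1 <= Phi k) -> (forall k, 0 <= Phi k) ->
  (forall k, Psi k.+1 <= Psi k) -> (forall k, 0 <= Psi k) ->
  (forall k, Phi k - Psi k =
     dotv (s k - p) (s k - p) - dotv (s k - q) (s k - q)) ->
  cluster_point s p -> cluster_point s q -> p = q.
Proof.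
move=> Phidec Phi0 Psidec Psi0 diff sp sq.
apply/eqP; rewrite -subr_eq0; apply/eqP/enorm_eq0; rewrite leNgt; apply/negP.
set m := enorm (p - q) => m0.
have m20 : 0 < m ^+ 2 / 2 by rewrite divr_gt0// exprn_gt0.
have [N1 PhiN] := nonincreasing_cauchy Phidec Phi0 m20.
have [N2 PsiN] := nonincreasing_cauchy Psidec Psi0 m20.
have m80 : 0 < m / 8 by rewrite divr_gt0.
have [k] := sp _ (maxn N1 N2) m80; have [j] := sq _ (maxn N1 N2) m80.
rewrite !geq_max => /andP[N1j N2j] jq /andP[N1k N2k] kp.
have := diff k; have := diff j; rewrite -!sqr_enorm.
have := PhiN _ N1k; have := PhiN _ N1j.
have := PsiN _ N2k; have := PsiN _ N2j.
have := nonincreasing_seqP Phidec N1k; have := nonincreasing_seqP Phidec N1j.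
have := nonincreasing_seqP Psidec N2k; have := nonincreasing_seqP Psidec N2j.
have := enormB_triangle p (s k) q; rewrite (enormBC p (s k)) -/m.
have := enormB_triangle p (s j) q; rewrite (enormBC p (s j)) -/m.
move: (enorm_ge0 (s k - p)) (enorm_ge0 (s j - q)) jq kp.
move: (enorm (s k - p)) (enorm (s k - q)) (enorm (s j - p)) (enorm (s j - q)).
move=> kp kq jp jq kp0 jq0 jqm kpm jpm kqm.
have : kp ^+ 2 <= (m / 8) ^+ 2 by rewrite ler_pXn2r ?nnegrE ?(ltW kpm)// ltW.
have : jq ^+ 2 <= (m / 8) ^+ 2 by rewrite ler_pXn2r ?nnegrE ?(ltW jqm)// ltW.
have : (7 / 8 * m) ^+ 2 <= kq ^+ 2 by rewrite ler_pXn2r ?nnegrE//; lra.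
have : (7 / 8 * m) ^+ 2 <= jp ^+ 2 by rewrite ler_pXn2r ?nnegrE//; lra.
move: m20; lra.
Qed.

End ClusterPoints.

(** The energy drop controls the perturbation of the gap recursion, up to the
    factor A': the first summand of the constant serves D and the second G. *)
Lemma perturbation_le_drop {R : realFieldType} (c rho w P A' l D G drop : R) :
  0 < c -> 0 < rho -> 0 < w -> 0 < l -> l <= P -> c * P <= A' ->
  0 <= D -> 0 <= G -> rho * l * A' * D + w * G <= drop ->
  l * (2 * P ^+ 2 * D + 2 * G) <=
    (2 / (rho * c ^+ 2) + 2 / (c * w)) * A' * drop.
Proof.
move=> c0 rho0 w0 l0 lP cP D0 G0 dropP.
have P0 : 0 < P by exact: lt_le_trans lP.
have PA : P <= A' / c by rewrite ler_pdivlMr// mulrC.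
have A'0 : 0 < A' by rewrite (lt_le_trans _ cP)// mulr_gt0.
set C1 := 2 / (rho * c ^+ 2); set C2 := 2 / (c * w).
have C10 : 0 <= C1 by rewrite divr_ge0// mulr_ge0 ?sqr_ge0// ltW.
have C20 : 0 <= C2 by rewrite divr_ge0// mulr_ge0// ltW.
have C120 : 0 <= (C1 + C2) * A' by rewrite mulr_ge0 ?addr_ge0// ltW.
apply: le_trans (ler_wpM2l C120 dropP).
have -> : (C1 + C2) * A' * (rho * l * A' * D + w * G) =
    2 * l * (A' / c) ^+ 2 * D + 2 * (A' / c) * G
    + (C1 * A' * (w * G) + C2 * A' * (rho * l * A' * D)).
  by rewrite /C1 /C2; field; rewrite !gt_eqF.
have : 0 <= C1 * A' * (w * G) + C2 * A' * (rho * l * A' * D).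
  have wG : 0 <= w * G by rewrite mulr_ge0// ltW.
  have lD : 0 <= rho * l * A' * D by rewrite !mulr_ge0// ltW.
  by rewrite addr_ge0// mulr_ge0// mulr_ge0// ltW.
have : 2 * l * P ^+ 2 * D <= 2 * l * (A' / c) ^+ 2 * D.
  rewrite ler_wpM2r// ler_wpM2l ?mulr_ge0 ?(ltW l0)//.
  by rewrite ler_pXn2r ?nnegrE ?(le_trans _ PA) ?(ltW P0).
have : 2 * l * G <= 2 * (A' / c) * G.
  by rewrite ler_wpM2r// ler_wpM2l// (le_trans lP).
lra.
Qed.

(** * Convergence of the method *)

Section Convergence.
Context {R : realType} {n : nat}.
Local Notation V := 'rV[R]_n.
Context {D : set V} {F : V -> V} {B : V -> set V} {X : set V}
  {sigma rho : R} {x0 : V} {lam : nat -> R} {x y u d : nat -> V} {lam_low : R}.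
Hypotheses (F_monotone : monotone_op (single D F))
  (F_continuous : {within D, continuous F})
  (B_maximal : maximal_monotone B)
  (domB_D : closure (odom B) `<=` D)
  (sigma01 : 0 < sigma < 1) (rho0h : 0 <= rho < 1 / 2)
  (X_nonempty : X !=set0) (X_closed : closed X) (X_convex : convex_set X)
  (domB_X : closure (odom B) `<=` X)
  (generated : maeg F B X sigma rho x0 lam x y u d)
  (lam_low_gt0 : 0 < lam_low)
  (lam_lower : forall k, lam_low < lam k.+1).
Local Notation T := (oadd (single D F) B).
Local Notation S := (minty D F B).
Let c := 1 - 2 * rho.
Let A k := c * Lambda lam k.
Let t k := lam k.+1 / (A k + lam k.+1).
Let K k := (A k + lam k.+1) / lam k.+1.
Let res k := dotv (y k.+1 - x k.+1) (y k.+1 - x k.+1).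
Let e k := lam k.+1 *: (F (y k.+1) - F (x k.+1)).
Let Phi z k := energy (A k) (d k) (y k) (u k) z.

Let c0 : 0 < c. Proof. by rewrite /c; case/andP: rho0h; lra. Qed.
Let c1 : c <= 1. Proof. by rewrite /c; case/andP: rho0h; lra. Qed.
Let rho01 : 0 <= rho <= 1.
Proof. by case/andP: rho0h => ? ?; apply/andP; split; lra. Qed.

Let sig2 : sigma ^+ 2 < 1.
Proof. by case/andP: sigma01 => s0 s1; rewrite expr_lt1// ltW. Qed.

Let lam_gt0 k : 0 < lam k.+1.
Proof. exact: lt_trans (lam_lower k). Qed.

Let A_0 : A 0 = 0. Proof. by rewrite /A /Lambda big_geq// mulr0. Qed.

Let A_S k : A k.+1 = A k + c * lam k.+1.
Proof. by rewrite /A /Lambda big_nat_recr//= mulrDr. Qed.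

Let A_growth k : c * lam_low * k%:R <= A k.
Proof.
elim: k => [|k IH]; first by rewrite mulr0 A_0.
rewrite A_S -natr1 mulrDr mulr1 lerD// ler_wpM2l// ?ltW//; exact: lam_lower.
Qed.

Let A_ge0 k : 0 <= A k.
Proof. by rewrite (le_trans _ (A_growth k))// !mulr_ge0// ltW. Qed.

Let A_mono k : 0 <= A k <= A k.+1.
Proof. by rewrite A_ge0 A_S lerDl mulr_ge0// ltW. Qed.

Let A_unbounded m : exists N, forall k, (N <= k)%N -> m < A k.
Proof.
exists (Num.truncn (m / (c * lam_low))).+1 => k Nk.
have cl0 : 0 < c * lam_low by rewrite mulr_gt0.
rewrite (lt_le_trans _ (A_growth k))// mulrC -ltr_pdivrMr//.
by rewrite (lt_le_trans (truncnS_gt _))// ler_nat.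
Qed.

Let init : [/\ u 0 = x0, y 0 = x0 & d 0 = 0].
Proof. by have [[]] := generated. Qed.

Let u_step k : u k.+1 = u k - (rho * lam k.+1) *: d k.+1.
Proof. by have [_ /(_ k)[]] := generated. Qed.

Let x_step k :
  x k.+1 = eproj X (t k *: u k + (1 - t k) *: (y k - lam k.+1 *: d k)).
Proof. by have [_ /(_ k)[[]]] := generated. Qed.

Let y_step k :
  y k.+1 = t k *: u k + (1 - t k) *: y k - lam k.+1 *: d k.+1 + e k.
Proof.
have [_ /(_ k)[_ -> _]] := generated; rewrite /= /tau /t -/c -/(A k) /e.
move: (_ / _) => tk; move: (tk *: u k + _) => w.
by apply/rowP => i; rewrite !mxE; field; rewrite gt_eqF.
Qed.

Let odomB_y k : odom B (y k.+1).
Proof.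
have [_ /(_ k)[[_ _ [p [_ ->]] [q [b Bb _] _] _] _ _]] := generated.
by exists b.
Qed.

Let D_y k : D (y k.+1).
Proof. exact/domB_D/subset_closure/odomB_y. Qed.

Let T_y k : T (y k.+1) (d k.+1).
Proof.
apply/oadd_singleP; split; first exact: D_y.
have [_ /(_ k)[[l0 _ [p [_ ->]] [q [b Bb <-] yq] _] -> _]] := generated.
rewrite addrK /id /= in yq *.
have -> // : (lam k.+1)^-1 *: (tau rho (Lambda lam k) (lam k.+1) *: u k +
    (1 - tau rho (Lambda lam k) (lam k.+1)) *: y k - y k.+1) - F (x k.+1) = b.
move: yq; set w := _ + _ *: y k => yq.
have -> : w = y k.+1 + lam k.+1 *: b + lam k.+1 *: F (x k.+1).
  by rewrite yq subrK.
have -> : y k.+1 + lam k.+1 *: b + lam k.+1 *: F (x k.+1) - y k.+1 =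
    lam k.+1 *: (b + F (x k.+1)).
  by apply/rowP => i; rewrite !mxE; ring.
by rewrite scalerA mulVf ?gt_eqF// scale1r addrK.
Qed.

Let e_small k : dotv (e k) (e k) <= sigma ^+ 2 * res k.
Proof.
have [_ /(_ k)[[l0 _ _ le_sig] _ _]] := generated.
have sig0 : 0 <= sigma by case/andP: sigma01 => /ltW.
rewrite /res enormBC (enormBC (x k.+1)) in le_sig.
rewrite /e /res -!sqr_enorm enormZ gtr0_norm// -exprMn.
by rewrite ler_pXn2r ?nnegrE ?mulr_ge0 ?enorm_ge0// ltW.
Qed.

Let T_monotone : monotone_op T.
Proof. exact: monotone_oadd B_maximal.1. Qed.

Let proj_obtuse k :
  dotv (t k *: u k + (1 - t k) *: (y k - lam k.+1 *: d k) - x k.+1)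
    (y k.+1 - x k.+1) <= 0.
Proof.
rewrite x_step.
have [_] := eprojP (t k *: u k + (1 - t k) *: (y k - lam k.+1 *: d k))
  X_nonempty X_closed X_convex.
by apply; exact/domB_X/subset_closure/odomB_y.
Qed.

Let increments_monotone k : 0 <= A k * dotv (d k.+1 - d k) (y k.+1 - y k).
Proof.
case: k => [|k]; first by rewrite A_0 mul0r.
by rewrite mulr_ge0// dotvC T_monotone.
Qed.

Let S_above z k : S z -> 0 <= dotv (d k.+1) (y k.+1 - z).
Proof. by move=> Sz; apply: Sz. Qed.

Let Phi_decay z k : S z ->
  rho * lam k.+1 * A k.+1 * dotv (d k.+1) (d k.+1)
    + (1 - sigma ^+ 2) / 2 * K k ^+ 2 * res k <= Phi z k - Phi z k.+1.
Proof.
move=> Sz.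
have := energy_decay (A_ge0 k) (lam_gt0 k) rho01 (y_step k) (e_small k)
  (proj_obtuse k) (increments_monotone k) (S_above k Sz).
rewrite -u_step -A_S -/(Phi z k) -/(Phi z k.+1) -/(res k) -/(K k).
have := mulr_ge0 (sqr_ge0 (rho * lam k.+1)) (dotv_ge0 (d k.+1)).
lra.
Qed.

Let Phi_lower z k : S z -> A k ^+ 2 * dotv (d k) (d k) <= 4 * Phi z k /\
  dotv (u k - z) (u k - z) <= 2 * Phi z k.
Proof.
move=> Sz; apply: energy_lower; case: k => [|k]; first by rewrite A_0 mul0r.
by rewrite mulr_ge0// S_above.
Qed.

Let Phi_ge0 z k : S z -> 0 <= Phi z k.
Proof.
by move=> Sz; have [_] := Phi_lower k Sz; have := dotv_ge0 (u k - z); lra.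
Qed.

Let res_ge0 k : 0 <= (1 - sigma ^+ 2) / 2 * K k ^+ 2 * res k.
Proof.
apply: mulr_ge0; last exact: dotv_ge0.
apply: mulr_ge0; last exact: sqr_ge0.
by rewrite divr_ge0// subr_ge0 ltW.
Qed.

Let shrink_ge0 k : 0 <= rho * lam k.+1 * A k.+1 * dotv (d k.+1) (d k.+1).
Proof. apply: mulr_ge0; last exact: dotv_ge0.
apply: mulr_ge0; last exact: A_ge0.
by have /andP[? _] := rho01; rewrite mulr_ge0// ltW. Qed.

Let Phi_noninc z k : S z -> Phi z k.+1 <= Phi z k.
Proof.
move=> Sz; have := Phi_decay k Sz; have := res_ge0 k; have := shrink_ge0 k.
lra.
Qed.

Let d_to0 z : S z -> enorm_cvg d 0.
Proof.
move=> Sz eps eps0.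
pose a := 4 * Phi z 0 + 1.
have a0 : 0 < a by rewrite ltr_wpDl// mulr_ge0// Phi_ge0.
have [N AN] := A_unbounded (a / eps).
exists N => k Nk; rewrite subr0.
have Ak0 : 0 < A k by rewrite (le_lt_trans _ (AN _ Nk))// divr_ge0// ltW.
have Ad : A k * enorm (d k) <= a.
  have Ad0 := mulr_ge0 (A_ge0 k) (enorm_ge0 (d k)).
  rewrite -(@ler_pXn2r _ 2) ?nnegrE ?(ltW a0)//.
  rewrite exprMn sqr_enorm; have [+ _] := Phi_lower k Sz.
  have := nonincreasing_seqP (fun k => Phi_noninc k Sz) (leq0n k).
  have : 0 <= Phi z 0 by exact: Phi_ge0.
  rewrite /a; nra.
rewrite -(ltr_pM2l Ak0) (le_lt_trans Ad)//.
by have := AN _ Nk; rewrite ltr_pdivrMr.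
Qed.

Let cluster_Sol z p : S z -> cluster_point y p -> Sol D F B p.
Proof.
move=> Sz yp; apply: approx_zeros_Sol => // eps eps0.
have [N dN] := d_to0 Sz eps0.
have [[//|k] Nk kp] := yp _ N.+1 eps0.
exists (y k.+1), (d k.+1); split=> //.
by rewrite -[d _]subr0; apply: dN; exact: ltnW.
Qed.

Let gap k : A k.+1 * dotv (y k.+1 - u k.+1) (y k.+1 - u k.+1) <=
  A k * dotv (y k - u k) (y k - u k)
  + lam k.+1 * (2 * (A k + lam k.+1) ^+ 2 * dotv (d k.+1) (d k.+1)
                + 2 * K k ^+ 2 * res k).
Proof.
have := gap_step (A_ge0 k) (lam_gt0 k) rho01 (ltW sig2) (y_step k) (e_small k).
rewrite -u_step -/(K k) -/(res k); apply: le_trans.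
by rewrite ler_wpM2r ?dotv_ge0// A_S lerD2l ler_piMl// ltW.
Qed.

Let lam_le k : lam k.+1 <= A k + lam k.+1.
Proof. by rewrite lerDr A_ge0. Qed.

Let c_le k : c * (A k + lam k.+1) <= A k.+1.
Proof. by rewrite A_S mulrDr lerD2r ler_piMl// A_ge0. Qed.

Let w0 : 0 < (1 - sigma ^+ 2) / 2.
Proof. by rewrite divr_gt0// subr_gt0. Qed.

Let G0 k : 0 <= K k ^+ 2 * res k.
Proof. by apply: mulr_ge0; [exact: sqr_ge0|exact: dotv_ge0]. Qed.

Let gap_to0 z : 0 < rho -> S z -> enorm_cvg (fun k => y k - u k) 0.
Proof.
move=> rho_gt0 Sz eps eps0.
pose C := 2 / (rho * c ^+ 2) + 2 / (c * ((1 - sigma ^+ 2) / 2)).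
have C0 : 0 <= C.
  by rewrite addr_ge0// divr_ge0// mulr_ge0 ?sqr_ge0// ltW.
have /(_ _ (exprn_gt0 2 eps0))[N sN] : forall r : R, 0 < r ->
    exists N, forall k, (N <= k)%N -> dotv (y k - u k) (y k - u k) < r.
  apply: (weighted_decay (b := fun=> 0) (Phi := Phi z) C0 A_mono A_unbounded).
  - by move=> k; exact: Phi_noninc.
  - by move=> k; exact: Phi_ge0.
  - by move=> r r0; exists 0%N => k _; exact: ltW.
  - move=> k; rewrite mulr0 addr0 (le_trans (gap k))// lerD2l.
    rewrite -[2 * K k ^+ 2 * res k]mulrA.
    apply: perturbation_le_drop => //; first exact: dotv_ge0.
    by rewrite [X in _ + X]mulrA; exact: Phi_decay.
by exists N => k Nk; rewrite subr0; apply: enorm_lt (sN _ Nk); exact: ltW.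
Qed.

Let u_bounded z k : S z -> enorm (u k) <= 2 * Phi z 0 + 1 + enorm z.
Proof.
move=> Sz; rewrite -[u k](subrK z) (le_trans (enormD _ _))// lerD2r.
have Phi00 : 0 <= Phi z 0 by exact: Phi_ge0.
apply: enorm_le; first lra.
have [_] := Phi_lower k Sz.
have := nonincreasing_seqP (fun k => Phi_noninc k Sz) (leq0n k).
nra.
Qed.

(** The limit is the only cluster point of u, and y shares it because the gap
    y - u closes. *)
Lemma maeg_cvg_pos z : 0 < rho -> Sol D F B z ->
  exists2 p, Sol D F B p & enorm_cvg y p /\ enorm_cvg u p.
Proof.
move=> rho_gt0 /(Sol_minty T_monotone) Sz.
have yu := gap_to0 rho_gt0 Sz.
have clusterS q : cluster_point u q -> Sol D F B q.
  move=> uq; apply: (cluster_Sol Sz) => eps N eps0.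
  have eps20 : 0 < eps / 2 by rewrite divr_gt0.
  have [N' N'yu] := yu _ eps20.
  have [k] := uq _ (maxn N N') eps20.
  rewrite geq_max => /andP[Nk /N'yu]; rewrite subr0 => yuk uqk.
  by exists k => //; have := enormB_triangle (y k) (u k) q; lra.
have [p up] := bounded_cluster_point (fun k => u_bounded k Sz).
have u_cvg : enorm_cvg u p.
  apply: unique_cluster_point_cvg (fun k => u_bounded k Sz) _ => q uq.
  have Sp := Sol_minty T_monotone (clusterS _ up).
  have Sq := Sol_minty T_monotone (clusterS _ uq).
  apply: (@opial _ _ u q p (Phi q) (Phi p)) => // k;
    rewrite ?Phi_ge0 ?Phi_noninc//.
  rewrite /Phi /energy; lra.
exists p; first exact: clusterS.
split=> // eps eps0; have eps20 : 0 < eps / 2 by rewrite divr_gt0.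
have [N1 N1u] := u_cvg _ eps20; have [N2 N2yu] := yu _ eps20.
exists (maxn N1 N2) => k; rewrite geq_max => /andP[/N1u uk /N2yu].
by rewrite subr0; have := enormB_triangle (y k) (u k) p; lra.
Qed.

Section Anchored.
Hypothesis rho_eq0 : rho = 0.

Let c_eq1 : c = 1. Proof. by rewrite /c rho_eq0 mulr0 subr0. Qed.

Let A_S1 k : A k.+1 = A k + lam k.+1.
Proof. by rewrite A_S c_eq1 mul1r. Qed.

Let u_const k : u k = x0.
Proof.
elim: k => [|k IH]; first by have [] := init.
by rewrite u_step rho_eq0 mul0r scale0r subr0.
Qed.

(* The residual is bounded by the drop of a convergent energy. *)
Let res_to0 z : S z -> forall eps, 0 < eps -> exists N, forall k, (N <= k)%N ->
  K k * enorm (y k.+1 - x k.+1) < eps.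
Proof.
move=> Sz eps eps0.
have [N PhiN] := nonincreasing_cauchy (fun k => Phi_noninc k Sz)
  (fun k => Phi_ge0 k Sz) (mulr_gt0 w0 (exprn_gt0 2 eps0)).
exists N => k Nk.
have K0 : 0 <= K k by rewrite divr_ge0 ?addr_ge0 ?A_ge0// ltW.
have Kr0 := mulr_ge0 K0 (enorm_ge0 (y k.+1 - x k.+1)).
rewrite -(@ltr_pXn2r _ 2) ?nnegrE ?(ltW eps0)// exprMn sqr_enorm -/(res k).
rewrite -(ltr_pM2l w0) mulrA (le_lt_trans _ (PhiN k.+1 (leqW Nk)))//.
have := Phi_decay k Sz; have := shrink_ge0 k.
have := nonincreasing_seqP (fun k => Phi_noninc k Sz) Nk.
lra.
Qed.

(* With u constant, the gap recursion keeps |y - x0|^2 below the bound H on the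
   perturbation, since |y - x0|^2 starts at 0. *)
Let y_bounded z : S z -> exists H, forall k, enorm (y k - z) <= H.
Proof.
move=> Sz; pose w := (1 - sigma ^+ 2) / 2.
pose H := 8 * Phi z 0 + 2 * (Phi z 0 / w).
have Phi00 : 0 <= Phi z 0 by exact: Phi_ge0.
have H0 : 0 <= H by rewrite addr_ge0 ?mulr_ge0 ?invr_ge0// ltW.
have Phi_le k : Phi z k <= Phi z 0.
  by have := nonincreasing_seqP (fun k => Phi_noninc k Sz) (leq0n k).
have bound k : dotv (y k - u k) (y k - u k) <= H.
  elim: k => [|k IH]; first by have [-> -> _] := init; rewrite subrr dotv0l.
  have A'0 : 0 < A k.+1 by rewrite A_S1 ltr_wpDl.
  rewrite -(ler_pM2l A'0) (le_trans (gap k))// A_S1 [leRHS]mulrDl lerD//.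
    by rewrite ler_wpM2l// A_ge0.
  rewrite ler_pM2l// /H lerD//.
    rewrite -A_S1; have [+ _] := Phi_lower k.+1 Sz; have := Phi_le k.+1.
    lra.
  rewrite -mulrA ler_pM2l// ler_pdivlMr// mulrC mulrA.
  have := Phi_decay k Sz; have := shrink_ge0 k; rewrite -/w.
  have := Phi_le k; have := Phi_ge0 k.+1 Sz; lra.
exists (H + 1 + enorm (x0 - z)) => k.
rewrite (le_trans (enormB_triangle _ x0 _))// lerD2r.
apply: enorm_le; first by rewrite addr_ge0.
by have := bound k; rewrite u_const; nra.
Qed.

(** The anchor x0 selects the limit, through its projection z0 onto [minty]. *)
Lemma maeg_cvg_anchored z : Sol D F B z ->
  enorm_cvg y (eproj (Sol D F B) x0).
Proof.
move=> /(Sol_minty T_monotone) Sz'.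
have [Sz obt] := eprojP x0 (ex_intro _ _ Sz') (@closed_minty _ _ D F B)
  (@convex_minty _ _ D F B).
set z0 := eproj S x0 in Sz obt.
have [H yH] := y_bounded Sz.
have H0 : 0 <= H by rewrite (le_trans (enorm_ge0 _) (yH 0%N)).
have y_bd k : enorm (y k) <= H + enorm z0.
  by rewrite -[y k](subrK z0) (le_trans (enormD _ _))// lerD2r.
have limsup eps : 0 < eps ->
    exists N, forall k, (N <= k)%N -> dotv (x0 - z0) (y k - z0) < eps.
  move=> eps0; apply: contrapT => /forallNP often.
  pose P k := eps <= dotv (x0 - z0) (y k - z0).
  have [|p yp] := @frequently_cluster _ _ y P _ y_bd.
    move=> N; have /existsNP[k /not_implyP[Nk /negP]] := often N.
    by rewrite -leNgt => ?; exists k.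
  have Sp : S p.
    apply/(Sol_minty T_monotone)/(cluster_Sol Sz) => eps' N eps'0.
    by have [k [Nk _ kp]] := yp eps' N eps'0; exists k.
  have a0 : 0 < enorm (x0 - z0) + 1 by rewrite ltr_wpDl ?enorm_ge0.
  have [k [_ + kp]] := yp _ 0%N (divr_gt0 eps0 a0).
  rewrite /P; have -> : y k - z0 = (y k - p) + (p - z0) by rewrite subrKA.
  rewrite dotvDr => far; have := obt _ Sp.
  have := dotv_le_enorm (x0 - z0) (y k - p).
  have : (enorm (x0 - z0) + 1) * enorm (y k - p) < eps.
    by rewrite mulrC -ltr_pdivlMr.
  by have := enorm_ge0 (y k - p); lra.
pose b k := 2 * dotv (x0 - z0) (y k.+1 - z0)
  + 2 * (K k * enorm (y k.+1 - x k.+1)) * enorm (y k.+1 - z0).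
have y_cvg : enorm_cvg y z0.
  move=> eps eps0.
  have /(_ _ (exprn_gt0 2 eps0))[N sN] : forall r : R, 0 < r ->
      exists N, forall k, (N <= k)%N -> dotv (y k - z0) (y k - z0) < r.
    apply: (weighted_decay (b := b) (Phi := fun=> 0) (lexx 0) A_mono A_unbounded)
      => //.
    - move=> e' e'0; have [|N1 N1P] := limsup (e' / 4); first by rewrite divr_gt0.
      have H1 : 0 < 4 * (H + 1) by rewrite mulr_gt0// ltr_wpDl.
      have [N2 N2P] := res_to0 Sz (divr_gt0 e'0 H1).
      exists (maxn N1 N2) => k; rewrite geq_max => /andP[N1k N2k].
      have dk := N1P _ (leqW N1k); have := N2P _ N2k; rewrite ltr_pdivlMr// => rk.
      have K0 : 0 <= K k by rewrite divr_ge0 ?addr_ge0 ?A_ge0// ltW.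
      have Kr0 := mulr_ge0 K0 (enorm_ge0 (y k.+1 - x k.+1)).
      have := ler_wpM2l Kr0 (yH k.+1); rewrite /b; lra.
    - move=> k; rewrite subrr mulr0 addr0 {1 2}A_S1 addrAC subrr add0r.
      have := anchored_step (A_ge0 k) (lam_gt0 k) (ltW sig2) (y_step k) (e_small k)
        (S_above k Sz).
      by rewrite u_const.
  by exists N => k Nk; apply: enorm_lt (sN _ Nk); exact: ltW.
have Solz0 : Sol D F B z0 by apply/(cluster_Sol Sz)/cluster_point_cvg.
rewrite (@eproj_obtuse _ _ _ _ z0)// => q Solq.
exact/obt/Sol_minty.
Qed.

End Anchored.

End Convergence.

Theorem theorem2 (R : realType) (n : nat)
    (D : set 'rV[R]_n) (F : 'rV[R]_n -> 'rV[R]_n)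
    (B : 'rV[R]_n -> set 'rV[R]_n) (X : set 'rV[R]_n)
    (sigma rho : R) (x0 : 'rV[R]_n)
    (lam : nat -> R) (x y u d : nat -> 'rV[R]_n) (lam_low M : R)
    (F_monotone : monotone_op (single D F))
    (F_continuous : {within D, continuous F})
    (B_maximal : maximal_monotone B)
    (domB_D : closure (odom B) `<=` D)
    (x0_domB : closure (odom B) x0)
    (sigma01 : 0 < sigma < 1)
    (rho0h : 0 <= rho < 1 / 2)
    (X_nonempty : X !=set0) (X_closed : closed X) (X_convex : convex_set X)
    (domB_X : closure (odom B) `<=` X) (X_D : X `<=` D)
    (Sol_nonempty : Sol D F B !=set0)
    (stepsize_exists : forall k, exists l x' y',
      accepted F B X sigma rho (Lambda lam k) (u k) (y k) (d k) l x' y')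
    (generated : maeg F B X sigma rho x0 lam x y u d)
    (lam_low_gt0 : 0 < lam_low) (M_gt1 : 1 < M)
    (lam_bounds : forall k, (1 <= k)%N -> lam_low < lam k < M * lam 1%N) :
  (rho = 0 -> y k @[k --> \oo] --> eproj (Sol D F B) x0) /\
  (0 < rho -> exists2 p, Sol D F B p &
     y k @[k --> \oo] --> p /\ u k @[k --> \oo] --> p).
Proof.
have lam_lower k : lam_low < lam k.+1.
  by have /andP[] := lam_bounds k.+1 isT.
have [z Solz] := Sol_nonempty.
split=> [rho_eq0|rho_gt0].
  apply: cvgn_enorm.
  exact: (maeg_cvg_anchored F_monotone F_continuous B_maximal domB_D sigma01 rho0h
    X_nonempty X_closed X_convex domB_X generated lam_low_gt0 lam_lower rho_eq0
    Solz).
have [p Solp [yp up]] := maeg_cvg_pos F_monotone F_continuous B_maximal domB_D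
  sigma01 rho0h X_nonempty X_closed X_convex domB_X generated lam_low_gt0
  lam_lower rho_gt0 Solz.
by exists p => //; split; exact: cvgn_enorm.
Qed.
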